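(* Let $G$ be a bipartite simple graph on $n$ vertices with $m$ edges. Suppose that $G$ admits an orientation $\sigma$ in which every cycle of $G$ is oddly oriented. Then $\mathcal{E}_{\mathrm{per}}(G)\le \sqrt{2mn}$.
   Context: An orientation of $G$ assigns a direction to each edge. A (necessarily even) cycle of $G$ is oddly oriented in the orientation $\sigma$ if, when traversing the cycle, an odd number of its edges are directed along the direction of traversal. The permanental polynomial is $\pi(G,x)=\operatorname{per}(xI-A(G))$, where $A(G)$ is the adjacency matrix and $\operatorname{per}(M)=\sum_{\sigma\in S_n}\prod_i m_{i,\sigma(i)}$; its roots $\mu_1,\dots,\mu_n\in\mathbb{C}$ are counted with multiplicity, and the permanental energy is $\mathcal{E}_{\mathrm{per}}(G)=\sum_{i=1}^n|\mu_i|$. *)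

(* Defs.v *)
From HB Require Import structures.
From mathcomp Require Import all_boot all_order all_algebra perm.
From mathcomp Require Import reals complex.

Set Implicit Arguments.
Unset Strict Implicit.
Unset Printing Implicit Defensive.

Import Order.TTheory GRing.Theory Num.Theory.
Local Open Scope ring_scope.

Record sgraph := SGraph {
  vertex :> finType;
  adj : rel vertex;
  adj_sym : symmetric adj;
  adj_irrefl : irreflexive adj }.

Arguments adj {s}.

(* Edges are the unordered pairs {u, v} of adjacent vertices. *)
Definition edges (G : sgraph) : {set {set G}} :=
  [set [set p.1; p.2] | p : G * G & adj p.1 p.2].

Definition bipartite (G : sgraph) : Prop :=
  exists A : {set G}, forall u v : G, adj u v -> (u \in A) != (v \in A).

(* [o u v] means that the edge {u, v} is directed from u to v; exactly one
   of the two directions is chosen for each edge (exclusive or). *)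
Definition orientation (G : sgraph) (o : rel G) : Prop :=
  (forall u v : G, o u v -> adj u v) /\
  (forall u v : G, adj u v -> o u v (+) o v u).

(* A cycle is listed by its distinct vertices in the order of a traversal,
   the last one being adjacent to the first one; length 2 is excluded because
   it would run twice through the same edge. *)
Definition graph_cycle (G : sgraph) (c : seq G) : bool :=
  [&& (2 < size c)%N, cycle adj c & uniq c].

(* [next c u] is the cyclic successor of [u], so that the edges of the cycle
   are the {u, next c u} and the traversal goes from [u] to [next c u]. *)
Definition oddly_oriented (G : sgraph) (o : rel G) (c : seq G) : bool :=
  odd (count (fun u => o u (next c u)) c).

Definition permanent (S : comNzRingType) (n : nat) (M : 'M[S]_n) : S :=
  \sum_(s : 'S_n) \prod_(i < n) M i (s i).

Definition adjacency_mx (S : nzRingType) (G : sgraph) : 'M[S]_#|G| :=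
  \matrix_(i, j) (adj (enum_val i) (enum_val j))%:R.

(* [char_poly_mx A] is the matrix x I - A over {poly S}. *)
Definition permanental_poly (S : comNzRingType) (G : sgraph) : {poly S} :=
  permanent (char_poly_mx (adjacency_mx S G)).

(* The complex roots with multiplicity: [closed_field_poly_normal p] provides
   a sequence [r] such that p = lead_coef p *: \prod_(z <- r) ('X - z%:P). *)
Definition permanental_roots (R : realType) (G : sgraph) : seq R[i] :=
  sval (closed_field_poly_normal (permanental_poly R[i] G)).

(* [normc z] is the modulus of [z], as an element of [R]. *)
Definition permanental_energy (R : realType) (G : sgraph) : R :=
  \sum_(z <- permanental_roots R G) ComplexField.Normc.normc z.

(* Main.v *)
(** Let [S] be the skew-adjacency matrix of the orientation. Expanding
    per(xI - A) and det(xI - S) over permutations and comparing the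
    contributions of each orbit, the two polynomials agree term by term: an
    orbit of length at least 2 with nonzero contribution has even length since
    the graph is bipartite, hence sign -1, and it contains an odd number of
    forward arcs (an edge run twice has exactly one), hence the product of the
    entries of [S] along it is also -1. The roots are therefore the eigenvalues
    of the normal matrix [S], so their squared moduli sum to the squared
    Frobenius norm 2m of [S], and Cauchy-Schwarz concludes. *)

Require Import Defs.
From HB Require Import structures.
From mathcomp Require Import all_boot all_order all_algebra perm.
From mathcomp Require Import reals complex.

Set Implicit Arguments.
Unset Strict Implicit.
Unset Printing Implicit Defensive.

Import Order.TTheory GRing.Theory Num.Theory.
Local Open Scope ring_scope.

(** * Orbits of a permutation: sign and parity *)

Lemma sum_card_porbits (T : finType) (s : {perm T}) :
  (\sum_(c in porbits s) #|c|)%N = #|T|.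
Proof.
rewrite -sum1_card (partition_big (porbit s) (mem (porbits s))) /=; last first.
  by move=> x _; apply: imset_f.
apply: eq_bigr => _ /imsetP[x _ ->]; rewrite -sum1_card.
by apply: eq_bigl => y; rewrite eq_porbit_mem.
Qed.

(** The parity of [s] is that of [#|T|] plus the number of orbits, and the exponents add up to
    exactly this number. *)
Lemma sign_perm_porbits (K : comNzRingType) (T : finType) (s : {perm T}) :
  (-1) ^+ s = \prod_(c in porbits s) (-1) ^+ #|c|.+1 :> K.
Proof.
rewrite -expr_sum; under eq_bigr do rewrite -addn1.
by rewrite big_split /= sum_card_porbits sum1_card -[RHS]signr_odd oddD.
Qed.

Lemma orbit_porbit (T : finType) (s : {perm T}) x :
  fingraph.orbit s x =i porbit s x.
Proof.
move=> y; apply/idP/idP => [/trajectP[i _ ->]|/porbitP[i ->]].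
  by rewrite -permX mem_porbit.
by rewrite permX -fconnect_orbit fconnect_iter.
Qed.

Lemma porbit_fix (T : finType) (s : {perm T}) x y :
  s y = y -> y \in porbit s x -> x = y.
Proof.
move=> sy; rewrite porbit_sym => /porbitP[i ->].
by rewrite permX; elim: i => //= i ->.
Qed.

Lemma perm_porbit (T : finType) (s : {perm T}) x y :
  (s y \in porbit s x) = (y \in porbit s x).
Proof. by rewrite -!eq_porbit_mem -[s y]/((s ^+ 1)%g y) porbit_perm. Qed.

(** Give each point the sign recording its side. Reindexing the product [P] of the signs along [s]
    flips every factor, so [P] equals itself times (-1) to the orbit length; since [P] is nonzero,
    that length is even. *)
Lemma even_bipartite_porbit (T : finType) (A : {pred T}) (s : {perm T}) x :
  {in porbit s x, forall y, (y \in A) != (s y \in A)} -> ~~ odd #|porbit s x|.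
Proof.
move=> sA; pose P : int := \prod_(y in porbit s x) (-1) ^+ (y \in A).
have P0 : P != 0 by apply/prodf_neq0 => y _; rewrite signr_eq0.
have: P = (-1) ^+ #|porbit s x| * P.
  rewrite {1}/P (reindex_inj (@perm_inj _ s)) /= -prodr_const -big_split /=.
  apply: eq_big => y; first exact: perm_porbit.
  rewrite perm_porbit => /sA; rewrite mulN1r; case: (y \in A); case: (s y \in A) => //= _.
rewrite -signr_odd; case: odd => // /eqP.
by rewrite expr1 mulN1r -addr_eq0 -mulr2n mulrn_eq0 (negPf P0).
Qed.

(** * Odd orientations along the orbits of a permutation *)

Section OddOrientation.

Variables (T : finType) (A : {pred T}) (e o : rel T).
Hypothesis eA : forall u v, e u v -> (u \in A) != (v \in A).
Hypothesis oe : forall u v, e u v -> o u v (+) o v u.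
Hypothesis odd_cycle : forall c, (2 < size c)%N -> cycle e c -> uniq c ->
  odd (count (fun u => o u (next c u)) c).

Lemma odd_forward_porbit (s : {perm T}) x :
  {in porbit s x, forall y, e y (s y)} ->
  odd (\sum_(y in porbit s x) o y (s y)).
Proof.
move=> se; set q := fingraph.orbit s x.
have uq : uniq q by apply: orbit_uniq.
have cq : cycle (frel s) q by apply/cycle_orbit/perm_inj.
have size_q : size q = #|porbit s x|.
  by rewrite -(card_uniqP uq); apply/eq_card/orbit_porbit.
have -> : (\sum_(y in porbit s x) o y (s y) = \sum_(y <- q) o y (s y))%N.
  by rewrite big_uniq //; apply: eq_bigl => y; rewrite /= orbit_porbit.
have x_q : x \in q by rewrite orbit_porbit porbit_id.
have e_q y : y \in q -> e y (s y) by rewrite orbit_porbit; apply: se.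
(* A nonempty orbit of even length cannot be a singleton. *)
have q_gt1 : (1 < size q)%N.
  have := even_bipartite_porbit (fun y yx => eA (se y yx)).
  by rewrite -size_q; case: (q) x_q => [|? []].
have [q_gt2|] := ltnP 2 (size q).
  have -> : (\sum_(y <- q) o y (s y))%N = count (fun u => o u (next q u)) q.
    rewrite -sum1_count [RHS]big_mkcond; apply: eq_big_seq => y.
    by move=> /(next_cycle cq)/eqP <-; case: (o _ _).
  apply: odd_cycle => //; apply: (cycle_from_next uq) => y yq.
  by rewrite -(eqP (next_cycle cq yq)) e_q.
(* Length two: [s] swaps [a] and [b], running once each way through a single edge, so exactly one of
   the two arcs is forward. *)
move: cq e_q q_gt1; clear -oe; case: q => [|a [|b []]] //= /and3P[/eqP ab /eqP ba _].
move=> /(_ a); rewrite mem_head => /(_ isT) /oe.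
by rewrite !big_cons big_nil ab ba addn0 oddD !oddb.
Qed.

(** The factors are negated skew entries, as in xI - S: each is -1 on a forward arc and 1 on a
    backward one, and the number of forward arcs is odd. *)
Lemma prod_skew_porbit (K : comNzRingType) (s : {perm T}) x :
  {in porbit s x, forall y, e y (s y)} ->
  \prod_(y in porbit s x) ((o (s y) y)%:R - (o y (s y))%:R) = -1 :> K.
Proof.
move=> se; transitivity (\prod_(y in porbit s x) (-1) ^+ o y (s y) : K).
  apply: eq_bigr => y /se /oe.
  by case: (o y _); case: (o _ y) => //= _; rewrite ?subr0 ?sub0r.
by rewrite -expr_sum -signr_odd odd_forward_porbit.
Qed.

End OddOrientation.

(** * The permanental polynomial as a characteristic polynomial *)

Definition skew_adjacency_mx (K : nzRingType) {G : sgraph} (o : rel G) :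
    'M[K]_#|G| :=
  \matrix_(i, j) ((o (enum_val i) (enum_val j))%:R -
                  (o (enum_val j) (enum_val i))%:R).

Lemma permanental_poly_odd_orientation (K : comNzRingType) (G : sgraph)
    (o : rel G) :
  bipartite G -> orientation o ->
  (forall c : seq G, graph_cycle c -> oddly_oriented o c) ->
  permanental_poly K G = char_poly (skew_adjacency_mx K o).
Proof.
move=> [A bipA] [o_adj o_xor] o_odd; pose ev : 'I_#|G| -> G := enum_val.
(* The permutations act on matrix indices, so the graph data are pulled back along [ev]. *)
pose e := relpre ev adj; pose A' := [pred i | ev i \in A].
have eA u v : e u v -> (u \in A') != (v \in A') by apply: bipA.
have oe u v : e u v -> relpre ev o u v (+) relpre ev o v u by apply: o_xor.
have odd_c c : (2 < size c)%N -> cycle e c -> uniq c ->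
    odd (count (fun u => relpre ev o u (next c u)) c).
  move=> c_gt2 ec uc; have := o_odd (map ev c).
  rewrite /graph_cycle size_map c_gt2 cycle_map ec.
  rewrite (map_inj_uniq enum_val_inj) uc => /(_ isT).
  rewrite /oddly_oriented count_map; congr odd; apply: eq_count => u /=.
  by rewrite (next_map enum_val_inj).
apply: eq_bigr => s _; rewrite sign_perm_porbits.
have part F : \prod_i F i (s i) =
    \prod_(c in porbits s) \prod_(i in c) F i (s i) :> {poly K}.
  rewrite (partition_big (porbit s) (mem (porbits s))) /=; last first.
    by move=> x _; apply: imset_f.
  apply: eq_bigr => _ /imsetP[x _ ->].
  by apply: eq_bigl => y; rewrite eq_porbit_mem.
rewrite 2!part -big_split; apply: eq_bigr => _ /imsetP[x _ ->] /=.
(* At a fixed point both diagonals vanish, so both sides contribute x. *)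
have [sx|sx] := eqVneq (s x) x.
  have -> : porbit s x = [set x].
    apply/setP => y; rewrite inE porbit_sym; apply/idP/eqP => [|->].
      exact: porbit_fix.
    exact: porbit_id.
  by rewrite cards1 !big_set1 sx !mxE adj_irrefl subrr sqrrN expr1n mul1r.
have s_neq y : y \in porbit s x -> (s y == y) = false.
  by move=> xy; apply: contraNF sx => /eqP sy; rewrite (porbit_fix sy xy) sy.
(* An orbit running along edges has even length: the permanent side gives 1, the determinant side
   the orbit sign -1 times a product -1. *)
have [/forall_inP se|] := boolP [forall y in porbit s x, e y (s y)].
  have even_x : ~~ odd #|porbit s x|.
    by apply: (@even_bipartite_porbit _ A') => y yx; apply/eA/se.
  transitivity (\prod_(y in porbit s x) (-1) : {poly K}).
    apply: eq_bigr => y yx; rewrite !mxE eq_sym s_neq // mulr0n sub0r.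
    by have := se y yx; rewrite /e /= => ->.
  rewrite prodr_const exprS -signr_odd (negPf even_x) mulr1 mulN1r.
  rewrite -[LHS]opprK -(prod_skew_porbit eA oe odd_c _ se); congr (- _).
  apply: eq_bigr => y yx; rewrite !mxE [y == _]eq_sym s_neq // mulr0n sub0r.
  by rewrite -polyCN opprB polyCB !polyC_natr.
(* Otherwise some step of the orbit is not an edge, and its zero entry kills both products. *)
rewrite negb_forall_in => /exists_inP[y yx nse].
rewrite !(bigD1 y yx) /= !mxE [y == _]eq_sym s_neq // [adj _ _](negPf nse).
have no u v : ~~ adj (ev u) (ev v) -> o (ev u) (ev v) = false.
  by move=> nuv; apply: contraNF nuv => /o_adj.
by rewrite !no // 1?adj_sym // !subrr !mul0r mulr0.
Qed.

(** * Counting edges, and spectra of normal matrices *)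

Lemma card_adj (G : sgraph) : #|[set p : G * G | adj p.1 p.2]| = (#|edges G|).*2.
Proof.
rewrite -sum1_card.
(* As there are no loops, the fibre over an edge consists of two distinct ordered pairs. *)
rewrite (partition_big (fun p : G * G => [set p.1; p.2]) (mem (edges G))) /=.
  rewrite -mul2n mulnC -sum_nat_const; apply: eq_bigr => _ /imsetP[[u v] /= uv ->].
  have uv_neq : u != v by apply: contraTneq uv => ->; rewrite inE adj_irrefl.
  rewrite sum1_card -(_ : #|[set (u, v); (v, u)]| = 2)%N; last first.
    by rewrite cards2 xpair_eqE (negPf uv_neq).
  apply: eq_card => -[a b]; rewrite !inE /= !xpair_eqE.
  apply/andP/orP => [[ab /eqP E]|].
    have ab_neq : a != b by apply: contraTneq ab => ->; rewrite inE adj_irrefl.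
    have := set21 a b; have := set22 a b; rewrite E !inE.
    move: ab_neq => /[swap] /orP[]/eqP-> /[swap] /orP[]/eqP->;
      by rewrite !eqxx //; auto.
  move: uv; rewrite !inE /= => uv.
  by case=> /andP[/eqP-> /eqP->]; split=> //; rewrite 1?adj_sym // setUC.
by move=> p; rewrite inE => p_adj; apply: imset_f; rewrite inE.
Qed.

(** [P] intertwines the two matrices inside the determinants too, and its determinant, a nonzero
    constant polynomial, can be cancelled. *)
Lemma similar_char_poly (K : fieldType) n (P M N : 'M[K]_n) :
  P \in unitmx -> P *m M = N *m P -> char_poly M = char_poly N.
Proof.
move=> uP PM; pose Q := map_mx (@polyC K) P.
have Q0 : \det Q != 0.
  by rewrite /Q det_map_mx polyC_eq0 -unitfE -unitmxE.
apply: (mulfI Q0); rewrite [RHS]mulrC -!det_mulmx; congr (\det _).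
by rewrite /char_poly_mx mulmxBr mulmxBl scalar_mxC -!map_mxM PM.
Qed.

Lemma char_poly_diag (K : comNzRingType) n (d : 'rV[K]_n) :
  char_poly (diag_mx d) = \prod_i ('X - (d 0 i)%:P).
Proof.
rewrite char_poly_trig ?diag_mx_is_trig //.
by apply: eq_bigr => i _; rewrite mxE eqxx.
Qed.

Local Open Scope sesquilinear_scope.

Lemma char_poly_spectral (C : numClosedFieldType) n (M : 'M[C]_n) :
  M \is normalmx -> char_poly M = \prod_i ('X - (spectral_diag M 0 i)%:P).
Proof.
move=> /orthomx_spectralP eM; rewrite -char_poly_diag.
apply: (similar_char_poly (spectral_unit M)).
by rewrite {2}eM !mulmxA mulmxV ?spectral_unit // mul1mx.
Qed.

Lemma trace_mul_adjoint (C : numClosedFieldType) m n (M : 'M[C]_(m, n)) :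
  \tr (M *m M ^t*) = \sum_i \sum_j `|M i j| ^+ 2.
Proof.
apply: eq_bigr => i _; rewrite mxE; apply: eq_bigr => j _.
by rewrite !mxE normCK.
Qed.

(** Both sides are traces of a matrix times its adjoint, which unitary conjugation preserves. *)
Lemma sum_sqr_norm_spectral (C : numClosedFieldType) n (M : 'M[C]_n) :
  M \is normalmx ->
  \sum_i `|spectral_diag M 0 i| ^+ 2 = \sum_i \sum_j `|M i j| ^+ 2.
Proof.
move=> /orthomx_spectralP eM; have uP := spectral_unitarymx M.
rewrite -trace_mul_adjoint {2 3}eM invmx_unitary //.
set P := spectralmx M in uP *; set d := spectral_diag M.
rewrite !trmx_mul !map_mxM trmxCK !mulmxA mulmxtVK //.
rewrite mxtrace_mulC !mulmxA (unitarymxP uP) mul1mx trace_mul_adjoint.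
apply: eq_bigr => i _; rewrite (bigD1 i) //= mxE eqxx mulr1n big1 ?addr0 // => j.
by rewrite mxE eq_sym => /negPf ->; rewrite mulr0n normr0 expr0n.
Qed.

(** Cauchy-Schwarz against the all-ones vector, from Lagrange's identity: the squared differences
    over all ordered pairs sum to twice the gap. *)
Lemma sqr_sum_le_card (F : realDomainType) n (a : 'I_n -> F) :
  (\sum_i a i) ^+ 2 <= n%:R * \sum_i a i ^+ 2.
Proof.
have : 0 <= \sum_i \sum_j (a i - a j) ^+ 2.
  by apply: sumr_ge0 => i _; apply: sumr_ge0 => j _; apply: sqr_ge0.
set S := \sum_i a i; set Q := \sum_i a i ^+ 2.
have -> : \sum_i \sum_j (a i - a j) ^+ 2 = (n%:R * Q - S ^+ 2) *+ 2.
  transitivity (\sum_i (a i ^+ 2 *+ n - a i * S *+ 2 + Q)).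
    apply: eq_bigr => i _; under eq_bigr do rewrite sqrrB.
    by rewrite big_split sumrB /= sumr_const card_ord sumrMnl -mulr_sumr.
  rewrite big_split sumrB /= !sumrMnl -mulr_suml sumr_const card_ord.
  by rewrite -/S -/Q -expr2 mulr_natl mulrnBl addrAC -mulr2n.
by rewrite pmulrn_lge0 // subr_ge0.
Qed.

(** * The skew-adjacency matrix and the energy bound *)

Lemma skew_adjacency_normal (C : numClosedFieldType) (G : sgraph) (o : rel G) :
  skew_adjacency_mx C o \is normalmx.
Proof.
have adjE : (skew_adjacency_mx C o) ^t* = - skew_adjacency_mx C o.
  by apply/matrixP => i j; rewrite !mxE rmorphB !rmorph_nat opprB.
by apply/normalmxP; rewrite adjE mulmxN mulNmx.
Qed.

(** Entries have modulus 1 at adjacent pairs and 0 elsewhere, so the sum counts ordered adjacent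
    pairs. *)
Lemma sum_sqr_norm_skew_adjacency (C : numClosedFieldType) (G : sgraph)
    (o : rel G) : orientation o ->
  \sum_i \sum_j `|skew_adjacency_mx C o i j| ^+ 2 = 2 * #|edges G|%:R.
Proof.
move=> [o_adj o_xor]; rewrite -natrM mul2n -card_adj -sum1_card natr_sum.
transitivity (\sum_(u : G) \sum_(v : G) (adj u v)%:R : C); last first.
  rewrite pair_bigA [RHS]big_mkcond; apply: eq_bigr => p _.
  by rewrite inE; case: (adj _ _).
rewrite [RHS](reindex _ (onW_bij _ (@enum_val_bij G))); apply: eq_bigr => i _ /=.
rewrite [RHS](reindex _ (onW_bij _ (@enum_val_bij G))); apply: eq_bigr => j _ /=.
rewrite !mxE; have [/o_xor|nij] := boolP (adj _ _).
  case: (o _ _); case: (o _ _) => //= _;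
    by rewrite ?subr0 ?sub0r ?normrN normr1 expr1n.
rewrite (contraNF (@o_adj _ _) nij) (contraNF (@o_adj _ _)) 1?adj_sym //.
by rewrite subrr normr0 expr0n.
Qed.

Local Close Scope sesquilinear_scope.

Theorem theorem4p4 (R : realType) (G : sgraph) (n m : nat)
    (hn : #|G| = n) (hm : #|edges G| = m)
    (hbip : bipartite G)
    (hodd : exists o : rel G, orientation o /\
       forall c : seq G, graph_cycle c -> oddly_oriented o c) :
  permanental_energy R G <= Num.sqrt (2 * m%:R * n%:R).
Proof.
have [o [or_o odd_o]] := hodd.
have normal_o := skew_adjacency_normal R[i] o.
set d := spectral_diag (skew_adjacency_mx R[i] o).
pose norm := @ComplexField.Normc.normc R.
have poly_d : permanental_poly R[i] G = \prod_i ('X - (d 0 i)%:P).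
  rewrite (permanental_poly_odd_orientation _ hbip or_o odd_o).
  exact: char_poly_spectral.
(* The chosen root sequence is known only up to order, which is enough for a sum; the leading
   coefficient is 1 by [poly_d]. *)
have roots_d : perm_eq (permanental_roots R G) [seq d 0 i | i <- enum 'I_#|G|].
  apply: prod_XsubC_eq; rewrite big_map big_enum /= -poly_d /permanental_roots.
  case: closed_field_poly_normal => r /= e; rewrite [RHS]e.
  by rewrite poly_d (monicP (monic_prod_XsubC _ _ _)) scale1r.
have norm_d : \sum_i norm (d 0 i) ^+ 2 = 2 * m%:R.
  (* The spectral identity lives in [R[i]], so the real equality is checked after embedding. *)
  apply: (@complexI R); rewrite rmorph_sum rmorphM !rmorph_nat -hm.
  rewrite -(sum_sqr_norm_skew_adjacency _ or_o) -sum_sqr_norm_spectral //.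
  by apply: eq_bigr => i _; rewrite rmorphXn.
have -> : permanental_energy R G = \sum_i norm (d 0 i).
  by rewrite /permanental_energy (perm_big _ roots_d) big_map big_enum.
have norm_ge0 z : 0 <= norm z by case: z => x y; apply: sqrtr_ge0.
(* The energy is nonnegative, hence the root of its square, and it suffices to compare under the
   root. *)
rewrite -[leLHS]ger0_norm ?sumr_ge0 // -sqrtr_sqr ler_wsqrtr //.
by rewrite mulrC -norm_d -hn sqr_sum_le_card.
Qed.
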